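(* Let $\mathfrak{g}_F$ be the free post-Lie algebra on one generator, realized as the free Lie algebra over the set of planar rooted trees with the left grafting product $\triangleright$, so that $\mathcal{U}(\mathfrak{g}_F)$ is the space of finite linear combinations of ordered forests. Then the product $\omega_1*\omega_2=(\omega_1)_{(1)}\big((\omega_1)_{(2)}\triangleright\omega_2\big)$ on $\mathcal{U}(\mathfrak{g}_F)$ is the Grossman--Larson product $\circ$, i.e. for all $\omega_1,\omega_2\in\mathcal{U}(\mathfrak{g}_F)$, $$\omega_1*\omega_2=\omega_1\circ\omega_2:=B^-\big(\omega_1\triangleright B^+(\omega_2)\big).$$
   Context: Let $k$ be a field of characteristic zero. $\mathrm{OT}$ is the set of planar (ordered) rooted trees; $\mathrm{OF}$ is the set of ordered forests, i.e. finite words in the alphabet $\mathrm{OT}$, including the empty word $\mathbf{1}$. For trees $\tau_1,\tau_2$, the left grafting $\tau_1\triangleright\tau_2$ is the sum, over all nodes $v$ of $\tau_2$, of the tree obtained by attaching the root of $\tau_1$ to $v$ by a new edge as the leftmost child of $v$. Let $\mathfrak{g}_F$ be the free Lie algebra over $k$ generated by $\mathrm{OT}$, with bracket $[\cdot,\cdot]$; left grafting extends to $\mathfrak{g}_F$ bilinearly by $x\triangleright[y,z]=[x\triangleright y,z]+[y,x\triangleright z]$ and $[x,y]\triangleright z=a_\triangleright(x,y,z)-a_\triangleright(y,x,z)$, where $a_\triangleright(x,y,z)=x\triangleright(y\triangleright z)-(x\triangleright y)\triangleright z$. This makes $\mathfrak{g}_F$ the free post-Lie algebra on the one-node tree. $\mathcal{U}(\mathfrak{g}_F)$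 is the free associative algebra on $\mathrm{OT}$ with basis $\mathrm{OF}$, product concatenation, and coshuffle coproduct $\Delta$: the algebra morphism with $\Delta(x)=x\otimes\mathbf{1}+\mathbf{1}\otimes x$ for $x\in\mathfrak{g}_F$; Sweedler notation $\Delta(A)=A_{(1)}\otimes A_{(2)}$. The product $\triangleright$ extends uniquely to a bilinear product on $\mathcal{U}(\mathfrak{g}_F)$ with $\mathbf{1}\triangleright A=A$; $(xA)\triangleright y=x\triangleright(A\triangleright y)-(x\triangleright A)\triangleright y$ for $x,y\in\mathfrak{g}_F$; $A\triangleright(BC)=(A_{(1)}\triangleright B)(A_{(2)}\triangleright C)$. $B^+$ is the linear map from forests to trees sending a forest $\tau_1\cdots\tau_p$ to the planar tree with a new root whose branches, from left to right, are $\tau_1,\dots,\tau_p$; $B^-$ is the inverse linear map, removing the root of a tree. *)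

(* Defs.v *)
From HB Require Import structures.
From mathcomp Require Import all_boot all_order all_algebra.
From mathcomp Require Import finmap monalg.

Set Implicit Arguments.
Unset Strict Implicit.
Unset Printing Implicit Defensive.

Import GRing.Theory.
Local Open Scope ring_scope.

(* The branches of the root, from left to right. *)
Inductive tree : Type := Node of seq tree.

Definition branches (t : tree) : seq tree := let: Node f := t in f.

Fixpoint tree_encode (t : tree) : GenTree.tree void :=
  let: Node f := t in GenTree.Node 0 [seq tree_encode u | u <- f].

Fixpoint tree_decode (g : GenTree.tree void) : tree :=
  if g is GenTree.Node _ s then Node [seq tree_decode u | u <- s] else Node [::].

Lemma tree_encodeK : cancel tree_encode tree_decode.
Proof.
rewrite /cancel; fix IH 1; case=> f /=; congr Node.
by elim: f => //= t f ->; rewrite IH.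
Qed.

HB.instance Definition _ := Countable.copy tree (can_type tree_encodeK).

(* One entry for each node v of t: the tree obtained by attaching s to v as   *)
(* the leftmost child of v. Equal trees coming from distinct nodes repeat.    *)
Fixpoint left_grafts (s t : tree) {struct t} : seq tree :=
  let: Node f := t in
  let fix in_branches (f : seq tree) : seq (seq tree) :=
    if f is u :: f' then
      [seq v :: f' | v <- left_grafts s u] ++ [seq u :: g | g <- in_branches f']
    else [::] in
  Node (s :: f) :: [seq Node g | g <- in_branches f].

(* The monoid of pairs of words, a basis of the tensor square of an algebra   *)
(* of words.                                                                  *)
Section ProductMonomial.
Variables M N : monomType.

Definition pair_one : M * N := (mone, mone).
Definition pair_mul (x y : M * N) : M * N := (mmul x.1 y.1, mmul x.2 y.2).

Fact pair_mulA : associative pair_mul.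
Proof. by move=> x y z; rewrite /pair_mul !mulmA. Qed.

Fact pair_mul1m : left_id pair_one pair_mul.
Proof. by case=> x y; rewrite /pair_mul /= !mul1m. Qed.

Fact pair_mulm1 : right_id pair_one pair_mul.
Proof. by case=> x y; rewrite /pair_mul /= !mulm1. Qed.

Fact pair_unitm x y :
  pair_mul x y = pair_one -> x = pair_one /\ y = pair_one.
Proof.
by case: x y => [x1 x2] [y1 y2] [] /unitm [-> ->] /unitm [-> ->].
Qed.

HB.instance Definition _ := Choice_isMonomialDef.Build (M * N)%type
  pair_mulA pair_mul1m pair_mulm1 pair_unitm.

End ProductMonomial.

Notation forest := {fmonom tree}.

(* U(g_F): the free associative algebra on trees; its product is the          *)
(* concatenation of forests and its unit is the empty forest.                 *)
Notation UgF k := {malg k[forest]}.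

(* U(g_F) (x) U(g_F), where << (f, g) >> stands for the tensor f (x) g.       *)
Notation UgF2 k := {malg k[(forest * forest)%type]}.

Section PostLie.
Variable k : fieldType.
Implicit Types x y z A B C : UgF k.

Definition tree_elt (t : tree) : UgF k := << FMonom [:: t] >>.

Definition bracket x y : UgF k := x * y - y * x.

(* The free Lie algebra on trees, realised as the Lie subalgebra generated by *)
(* the trees inside the free associative algebra, which is its enveloping     *)
(* algebra.                                                                   *)
Inductive gF : UgF k -> Prop :=
| gF_tree t : gF (tree_elt t)
| gF_0 : gF 0
| gF_add x y : gF x -> gF y -> gF (x + y)
| gF_scale (a : k) x : gF x -> gF (a *: x)
| gF_bracket x y : gF x -> gF y -> gF (bracket x y).

(* The algebra morphism sending each tree t to t (x) 1 + 1 (x) t.             *)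
Definition coshuffle A : UgF2 k :=
  \sum_(f <- msupp A) A@_f *:
    \prod_(t <- fmonom_val f)
      (<< (FMonom [:: t], mone) >> + << (mone, FMonom [:: t]) >>).

(* sweedler b A is the sum of the b A_(1) A_(2), for b bilinear.              *)
Definition sweedler (b : UgF k -> UgF k -> UgF k) A : UgF k :=
  \sum_(p <- msupp (coshuffle A)) (coshuffle A)@_p *: b << p.1 >> << p.2 >>.

Definition associator (tri : UgF k -> UgF k -> UgF k) x y z : UgF k :=
  tri x (tri y z) - tri (tri x y) z.

Record post_lie_grafting (tri : UgF k -> UgF k -> UgF k) : Prop := {
  tri_linearl : forall (a : k) x y z, tri (a *: x + y) z = a *: tri x z + tri y z;
  tri_linearr : forall (a : k) x y z, tri x (a *: y + z) = a *: tri x y + tri x z;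
  tri_gF : forall x y, gF x -> gF y -> gF (tri x y);
  tri_tree : forall s t,
    tri (tree_elt s) (tree_elt t) = \sum_(u <- left_grafts s t) tree_elt u;
  tri_bracketr : forall x y z, gF x -> gF y -> gF z ->
    tri x (bracket y z) = bracket (tri x y) z + bracket y (tri x z);
  tri_bracketl : forall x y z, gF x -> gF y -> gF z ->
    tri (bracket x y) z = associator tri x y z - associator tri y x z;
  tri_1l : forall A, tri 1 A = A;
  tri_mull : forall x A y, gF x -> gF y ->
    tri (x * A) y = tri x (tri A y) - tri (tri x A) y;
  tri_mulr : forall A B C,
    tri A (B * C) = sweedler (fun A1 A2 => tri A1 B * tri A2 C) A
}.

Definition Bplus A : UgF k := \sum_(f <- msupp A) A@_f *: tree_elt (Node f).

(* Inverse of Bplus on the span of trees; the value 0 on the forests that are *)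
(* not a single tree is a convention.                                         *)
Definition Bminus A : UgF k :=
  \sum_(f <- msupp A)
    (if fmonom_val f is [:: t] then A@_f *: << FMonom (branches t) >> else 0).

Definition star (tri : UgF k -> UgF k -> UgF k) A B : UgF k :=
  sweedler (fun A1 A2 => A1 * tri A2 B) A.

Definition grossman_larson (tri : UgF k -> UgF k -> UgF k) A B : UgF k :=
  Bminus (tri A (Bplus B)).

End PostLie.

(* Main.v *)
From HB Require Import structures.
Require Import Defs.
From mathcomp Require Import all_boot all_order all_algebra.
From mathcomp Require Import finmap monalg.

Set Implicit Arguments.
Unset Strict Implicit.
Unset Printing Implicit Defensive.

Import GRing.Theory.
Local Open Scope ring_scope.

(** Write t for a tree, F for a forest and h for the forests obtained by
grafting t on a node of F, so that t |> F is the sum of the h (t acts by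
derivations, and kills the empty forest).  Everything rests on one recursion,
the lemma tri_cons:

  (t F) |> B = t |> (F |> B) - sum_h (h |> B)     for every B.

The axioms of a post-Lie algebra give it for B in the Lie algebra only.  Both
sides vanish when B = 1, and both are compatible with products: since t |> is a
coderivation for the coshuffle coproduct (splits_branch_grafts), expanding
either side at B = u C along the coproduct of F reduces it to the cases u
and C.  Hence it holds for all forests B.

The case B = 1 needs F |> 1 = 0 for nonempty F.  As 1 = 1 1, the form
F |-> F |> 1 is an idempotent for convolution, equal to 1 on the empty forest;
comparing the two extreme terms of the coproduct, by induction on the length
of F, shows that such an idempotent is the counit (convolution_idempotent).

The recursion turns into the same kind of recursion for the product * of the
statement (starU_cons):

  (t F) * B = t (F * B) + t |> (F * B) - sum_h (h * B).

On the other side, t either is grafted on the root of the tree B^+(C), which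
puts it in front of C, or on one of the branches:

  t |> B^+(C) = B^+(t C + t |> C)     (tri_tree_bplus).

Every h has the length of F, so induction on the length of F combines the
three identities into F |> B^+(B) = B^+(F * B) (tri_bplus), and B^- is a left
inverse of B^+. *)

(** * Linear maps out of a space with a basis *)

Lemma is_linear_sum (k : pzRingType) (U V : lmodType k) (f : U -> V) :
  linear f -> forall (I : Type) (s : seq I) (F : I -> U),
  f (\sum_(i <- s) F i) = \sum_(i <- s) f (F i).
Proof.
move=> lf I s F.
pose phi : {linear U -> V} := HB.pack f (GRing.isLinear.Build _ _ _ _ f lf).
exact: (raddf_sum phi).
Qed.

Lemma is_linear_scale (k : pzRingType) (U V : lmodType k) (f : U -> V) :
  linear f -> forall a A, f (a *: A) = a *: f A.
Proof.
move=> lf a A.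
pose phi : {linear U -> V} := HB.pack f (GRing.isLinear.Build _ _ _ _ f lf).
exact: (linearZ_LR phi).
Qed.

Lemma is_linear_add (k : pzRingType) (U V : lmodType k) (f : U -> V) :
  linear f -> {morph f : A B / A + B}.
Proof. by move=> lf A B; have := lf 1 A B; rewrite !scale1r. Qed.

Lemma is_linear_zero (k : pzRingType) (U V : lmodType k) (f : U -> V) :
  linear f -> f 0 = 0.
Proof.
by move=> lf; rewrite -[0 in LHS](scale0r 0) is_linear_scale // scale0r.
Qed.

Section LinearExtension.
Variables (k : fieldType) (K : choiceType) (V : lmodType k).
Implicit Types (A B : {malg k[K]}) (f g : {malg k[K]} -> V).

Lemma linear_expand f : linear f ->
  forall A, f A = \sum_(x <- msupp A) A@_x *: f << x >>.
Proof.
move=> lf A; rewrite [in LHS](monalgE A) is_linear_sum //.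
apply: eq_bigr => x _; rewrite -is_linear_scale //; congr f; apply/malgP => y.
by rewrite mcoeffZ !mcoeffU mulrnAr mulr1.
Qed.

Lemma linear_eq_on_basis f g :
  linear f -> linear g -> (forall x, f << x >> = g << x >>) -> f =1 g.
Proof.
move=> lf lg fg A; rewrite (linear_expand lf) (linear_expand lg).
by apply: eq_bigr => x _; rewrite fg.
Qed.

(** The maps coshuffle, Bplus and Bminus are all of this form, which is how their
linearity is obtained. *)
Definition linext (h : K -> V) A : V := \sum_(x <- msupp A) A@_x *: h x.

Lemma linextEw h A (d : {fset K}) : (msupp A `<=` d)%fset ->
  linext h A = \sum_(x <- d) A@_x *: h x.
Proof.
move=> le; apply/big_fset_incl => // x _ /mcoeff_outdom ->.
by rewrite scale0r.
Qed.

Lemma linext_is_linear h : linear (linext h).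
Proof.
move=> a A B; pose d := (msupp A `|` msupp B)%fset.
have le : (msupp (a *: A + B) `<=` d)%fset.
  by apply: (fsubset_trans (msuppD_le _ _)); apply: fsetSU; exact: msuppZ_le.
rewrite !(@linextEw h _ d) ?fsubsetUl ?fsubsetUr // scaler_sumr -big_split.
by apply: eq_bigr => x _; rewrite mcoeffD mcoeffZ scalerDl scalerA.
Qed.

Lemma linext_basis h x : linext h << x >> = h x.
Proof. by rewrite /linext msuppU oner_eq0 big_seq_fset1 mcoeffUU scale1r. Qed.

End LinearExtension.

(** * Splitting forests and grafting on them *)

Section Words.
Implicit Types (t u : tree) (f g h : seq tree).

(** The terms of the coshuffle coproduct of f, as pairs of complementary
subwords, with repetitions. *)
Fixpoint splits f : seq (seq tree * seq tree) :=
  if f is t :: f' then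
    [seq (t :: p.1, p.2) | p <- splits f'] ++
    [seq (p.1, t :: p.2) | p <- splits f']
  else [:: ([::], [::])].

Lemma big_splits_cons (V : nmodType) t f (b : seq tree * seq tree -> V) :
  \sum_(p <- splits (t :: f)) b p =
  \sum_(p <- splits f) b (t :: p.1, p.2) +
  \sum_(p <- splits f) b (p.1, t :: p.2).
Proof. by rewrite big_cat !big_map. Qed.

(** Cocommutativity of the coshuffle coproduct. *)
Lemma big_splits_swap (V : nmodType) f (b : seq tree -> seq tree -> V) :
  \sum_(p <- splits f) b p.1 p.2 = \sum_(p <- splits f) b p.2 p.1.
Proof.
elim: f b => [|t f IH] b; first by rewrite !big_seq1.
rewrite !big_splits_cons /= addrC (IH (fun g h => b g (t :: h))).
by rewrite (IH (fun g h => b (t :: g) h)).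
Qed.

(** (f, [::]) is the only splitting with an empty second part. *)
Lemma sum_splits_nil (V : nmodType) f (b : seq tree -> seq tree -> V) :
  (forall g h, (0 < size h <= size f)%N -> b g h = 0) ->
  \sum_(p <- splits f) b p.1 p.2 = b f [::].
Proof.
elim: f b => [|t f IH] b b0; first by rewrite big_seq1.
rewrite big_splits_cons /= (IH (fun g => b (t :: g))).
  rewrite (IH (fun g h => b g (t :: h))) ?(b0 _ [:: t]) ?addr0 //.
  by move=> g h /andP[h0 hf]; rewrite b0.
by move=> g h /andP[h0 hf]; rewrite b0 // h0 leqW.
Qed.

(** If e vanishes on the shorter nonempty words, then only the two trivial
splittings of f contribute to e f, each of them for e f; hence e f is twice
itself. *)
Lemma convolution_idempotent (R : nzRingType) (e : seq tree -> R) f :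
  e [::] = 1 -> (forall g, e g = \sum_(p <- splits g) e p.1 * e p.2) ->
  f != [::] -> e f = 0.
Proof.
move=> e_nil e_conv; have [n] := ubnP (size f).
elim: n f => // n IH [|t f] //= fn _.
have e0 h : (0 < size h <= size f)%N -> e h = 0.
  case/andP=> h0 hf; apply: IH; first exact: leq_ltn_trans hf fn.
  by rewrite -size_eq0 -lt0n.
have e_tf : e (t :: f) = e (t :: f) + e (t :: f).
  rewrite {1}e_conv big_splits_cons /=.
  rewrite [X in _ + X](big_splits_swap _ (fun g h => e g * e (t :: h))).
  rewrite (sum_splits_nil (b := fun g h => e (t :: g) * e h)) => [|g h /e0 ->].
    rewrite (sum_splits_nil (b := fun g h => e h * e (t :: g)))
      => [|g h /e0 ->].
      by rewrite e_nil mulr1 mul1r.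
    by rewrite mul0r.
  by rewrite mulr0.
by move/eqP: e_tf; rewrite -subr_eq subrr eq_sym => /eqP.
Qed.

(** The terms of the grafting of t on a forest.  It is the inner loop of
left_grafts, which a fixpoint hides from proofs. *)
Fixpoint branch_grafts t f : seq (seq tree) :=
  if f is u :: f' then
    [seq v :: f' | v <- left_grafts t u] ++
    [seq u :: g | g <- branch_grafts t f']
  else [::].

Lemma left_grafts_Node t f :
  left_grafts t (Node f) =
    Node (t :: f) :: [seq Node g | g <- branch_grafts t f].
Proof.
rewrite /=; congr (_ :: map _ _).
by elim: f => //= u f ->.
Qed.

Lemma size_branch_grafts t f g : g \in branch_grafts t f -> size g = size f.
Proof.
elim: f g => // u f IH g; rewrite mem_cat => /orP[] /mapP[h hin ->] //=.
by rewrite (IH h).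
Qed.

(** Grafting a tree is a coderivation: the tree grafted on lands in one of the
two parts of a splitting, and grafting before or after splitting is the same. *)
Lemma splits_branch_grafts (V : nmodType) t f (b : seq tree * seq tree -> V) :
  \sum_(h <- branch_grafts t f) \sum_(p <- splits h) b p =
  \sum_(p <- splits f) (\sum_(h <- branch_grafts t p.1) b (h, p.2) +
                        \sum_(h <- branch_grafts t p.2) b (p.1, h)).
Proof.
elim: f b => [|u f IH] b; first by rewrite big_nil big_seq1 !big_nil addr0.
rewrite big_splits_cons /= big_cat !big_map /=.
under eq_bigr do rewrite big_splits_cons.
under [X in _ + X = _]eq_bigr do rewrite big_splits_cons.
rewrite !big_split /= !IH.
rewrite [X in X + _ + _ = _]exchange_big [X in _ + X + _ = _]exchange_big /=.
rewrite addrACA -!big_split /=.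
apply: eq_bigr => p _; rewrite !big_cat !big_map /=.
by congr (_ + _); [rewrite addrA | rewrite addrCA].
Qed.

End Words.

(** * The recursion for the action of a forest *)

(** The argument takes place in any algebra U spanned by the images of the words
in trees.  The only properties of the free algebra that it uses are those
below; tri_word_mul and starU_word are the coproduct formulas on words. *)
Section GraftingOnWords.
Variables (k : fieldType) (U : lalgType k).
Implicit Types (A B C : U) (t u : tree) (f g h : seq tree).

Variable word : seq tree -> U.
Hypothesis word_nil : word [::] = 1.
Hypothesis word_cons : forall t f, word (t :: f) = word [:: t] * word f.
Hypothesis linear_eq_on_words : forall F G : U -> U,
  linear F -> linear G -> (forall f, F (word f) = G (word f)) -> F =1 G.
Hypothesis mul_is_linearr : forall A, linear ( *%R A).

Variable tri : U -> U -> U.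
Hypothesis tri_is_linearl : forall B, linear (tri^~ B).
Hypothesis tri_is_linearr : forall A, linear (tri A).
Hypothesis tri_unitl : forall A, tri 1 A = A.
Hypothesis tri_tree_tree : forall t u,
  tri (word [:: t]) (word [:: u]) = \sum_(v <- left_grafts t u) word [:: v].
Hypothesis tri_word_mul : forall f B C,
  tri (word f) (B * C) =
  \sum_(p <- splits f) tri (word p.1) B * tri (word p.2) C.
Hypothesis tri_word_tree : forall t f u,
  tri (word (t :: f)) (word [:: u]) =
  tri (word [:: t]) (tri (word f) (word [:: u])) -
  tri (tri (word [:: t]) (word f)) (word [:: u]).

Variable starU : U -> U -> U.
Hypothesis starU_is_linearl : forall B, linear (starU^~ B).
Hypothesis starU_word : forall f B,
  starU (word f) B = \sum_(p <- splits f) word p.1 * tri (word p.2) B.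

Variable bplus : U -> U.
Hypothesis bplus_is_linear : linear bplus.
Hypothesis bplus_word : forall f, bplus (word f) = word [:: Node f].

(** The equality 1 = 1 1 makes f |-> tri (word f) 1 a convolution idempotent. *)
Lemma tri_word_1 f : f != [::] -> tri (word f) 1 = 0.
Proof.
apply: (convolution_idempotent (e := fun g => tri (word g) 1)) => [|g].
  by rewrite word_nil tri_unitl.
by rewrite -tri_word_mul mulr1.
Qed.

Lemma tri_tree_mul t B C :
  tri (word [:: t]) (B * C) = tri (word [:: t]) B * C + B * tri (word [:: t]) C.
Proof. by rewrite tri_word_mul big_cons big_seq1 /= word_nil !tri_unitl. Qed.

Lemma tri_tree_word t f :
  tri (word [:: t]) (word f) = \sum_(g <- branch_grafts t f) word g.
Proof.
elim: f => [|u f IH]; first by rewrite big_nil word_nil tri_word_1.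
rewrite (word_cons u) tri_tree_mul tri_tree_tree IH big_cat !big_map /=.
rewrite mulr_suml mulr_sumr.
by congr (_ + _); apply: eq_bigr => h _; rewrite -word_cons.
Qed.

(** The key recursion.  The axiom gives it for B a tree; it is extended to words
B by induction on their length, simultaneously for all f, because the coproduct
replaces f by its subwords. *)
Lemma tri_cons t f B :
  tri (word (t :: f)) B =
  tri (word [:: t]) (tri (word f) B) -
  \sum_(h <- branch_grafts t f) tri (word h) B.
Proof.
pose rhs f C := tri (word [:: t]) (tri (word f) C) -
  \sum_(h <- branch_grafts t f) tri (word h) C.
rewrite -[RHS]/(rhs f B); move: B.
have rhs_lin : linear (rhs f).
  move=> a A B; rewrite /rhs !tri_is_linearr.
  under eq_bigr do rewrite tri_is_linearr.
  by rewrite big_split -scaler_sumr opprD scalerBr addrACA.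
apply: linear_eq_on_words => // g; elim: g f {rhs_lin} => [|u g IH] f.
  rewrite word_nil tri_word_1 // /rhs; case: f => [|u f].
    by rewrite big_nil word_nil tri_unitl tri_word_1 ?subr0.
  rewrite (@tri_word_1 (u :: f)) // (is_linear_zero (tri_is_linearr _)).
  rewrite big1_seq ?subr0 // => h /andP[_ /size_branch_grafts hs].
  by rewrite tri_word_1 // -size_eq0 hs.
(* Both sides become sums over the splittings of f, compared termwise. *)
rewrite (word_cons u g) tri_word_mul big_splits_cons /rhs /=.
under [X in _ - X]eq_bigr do rewrite tri_word_mul.
rewrite splits_branch_grafts tri_word_mul (is_linear_sum (tri_is_linearr _)).
rewrite -sumrB -big_split; apply: eq_bigr => p _ /=.
rewrite tri_tree_mul tri_word_tree tri_tree_word IH /rhs.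
rewrite (is_linear_sum (tri_is_linearl _)).
by rewrite mulrBl mulrBr mulr_suml mulr_sumr opprD addrACA.
Qed.

(** By tri_cons when t goes to the second factor of the coproduct; the
coderivation property rearranges the corrections, and the part of the sum over
h that grafts t on the first factor cancels the same terms in the derivation
tri (word [:: t]) of the product. *)
Lemma starU_cons t f B :
  starU (word (t :: f)) B =
  word [:: t] * starU (word f) B + tri (word [:: t]) (starU (word f) B) -
  \sum_(h <- branch_grafts t f) starU (word h) B.
Proof.
under [X in _ - X]eq_bigr do rewrite starU_word.
rewrite !starU_word big_splits_cons /= splits_branch_grafts.
rewrite (is_linear_sum (tri_is_linearr _)) mulr_sumr -addrA -sumrB.
congr (_ + _); apply: eq_bigr => p _ /=; first by rewrite word_cons mulrA.
rewrite tri_tree_mul tri_cons tri_tree_word mulrBr mulr_suml mulr_sumr.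
by rewrite opprD addrACA subrr add0r.
Qed.

(** The root of bplus B receives t as its leftmost branch; the other nodes lie
in the branches, that is, in B. *)
Lemma tri_tree_bplus t B :
  tri (word [:: t]) (bplus B) = bplus (word [:: t] * B + tri (word [:: t]) B).
Proof.
move: B; apply: linear_eq_on_words => [a A B | a A B | g].
- by rewrite bplus_is_linear tri_is_linearr.
- by rewrite tri_is_linearr mul_is_linearr -bplus_is_linear scalerDr addrACA.
rewrite bplus_word tri_tree_tree left_grafts_Node big_cons big_map -word_cons.
rewrite (is_linear_add bplus_is_linear) bplus_word tri_tree_word.
rewrite (is_linear_sum bplus_is_linear).
by congr (_ + _); apply: eq_bigr => h _; rewrite bplus_word.
Qed.

(** Grafting on a forest keeps its length, so the correction terms of both
recursions are covered by the induction on the length of f. *)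
Lemma tri_bplus A B : tri A (bplus B) = bplus (starU A B).
Proof.
move: A; apply: linear_eq_on_words => [|a A C|f]; first exact: tri_is_linearl.
  by rewrite starU_is_linearl bplus_is_linear.
have [n] := ubnP (size f); elim: n f => // n IH [|t f] fn.
  by rewrite starU_word big_seq1 /= word_nil mul1r !tri_unitl.
rewrite tri_cons starU_cons IH // tri_tree_bplus big_seq.
under eq_bigr => h /size_branch_grafts hf do rewrite IH ?hf //.
rewrite -big_seq -(is_linear_sum bplus_is_linear) -[LHS]addrC -scaleN1r.
rewrite -bplus_is_linear.
by rewrite scaleN1r addrC.
Qed.

End GraftingOnWords.

(** * The free associative algebra on trees *)

Section MonoidAlgebra.
Variables (k : fieldType) (M : monomType).
Implicit Types (A B C : {malg k[M]}).

Lemma malg_mul_basis (x y : M) :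
  << x >> * << y >> = << mmul x y >> :> {malg k[M]}.
Proof. by rewrite malgM_def fgmulUU mulr1. Qed.

Lemma malg_scalerAr a A B : A * (a *: B) = a *: (A * B).
Proof.
apply/malgP => x; rewrite mcoeffZ [in RHS]mcoeffMl.
rewrite (mcoeffMlw _ (fsubset_refl _) (@msuppZ_le _ _ a B)) mulr_sumr.
apply: eq_bigr => y _; rewrite mulr_sumr; apply: eq_bigr => z _.
by rewrite mcoeffZ mulrCA mulrnAr.
Qed.

Lemma malg_mul_is_linearr A : linear ( *%R A).
Proof. by move=> a B C; rewrite mulrDr malg_scalerAr. Qed.

End MonoidAlgebra.

Section FreeAlgebra.
Variable k : fieldType.
Implicit Types (t u : tree) (f g : seq tree) (A B C : UgF k).

Definition word f : UgF k := << FMonom f >>.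

Lemma word_nil : word [::] = 1.
Proof. by rewrite /word -fmoneE. Qed.

Lemma word_cons t f : word (t :: f) = word [:: t] * word f.
Proof. by rewrite /word malg_mul_basis -[mmul _ _]fmK fmM. Qed.

Lemma coshuffle_word f :
  coshuffle (word f) = \sum_(p <- splits f) << (FMonom p.1, FMonom p.2) >>.
Proof.
rewrite /coshuffle /word msuppU1 big_seq_fset1 mcoeffUU scale1r /=.
elim: f => [|t f IH]; first by rewrite big_nil big_seq1 /= -fmoneE.
rewrite big_cons IH big_splits_cons mulrDl.
congr (_ + _); rewrite mulr_sumr; apply: eq_bigr => p _;
  rewrite malg_mul_basis; congr << _ >>.
  by congr pair; rewrite /= ?mul1m // -[LHS]fmK fmM.
by congr pair; rewrite /= ?mul1m // -[LHS]fmK fmM.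
Qed.

Lemma sweedler_is_linear b : linear (@sweedler k b).
Proof.
have coshuffle_is_linear : linear (@coshuffle k) by exact: linext_is_linear.
move=> a A B; rewrite /sweedler coshuffle_is_linear.
exact: (linext_is_linear (fun p => b << p.1 >> << p.2 >>)).
Qed.

Lemma sweedler_word b f :
  sweedler b (word f) = \sum_(p <- splits f) b (word p.1) (word p.2).
Proof.
pose h (p : forest * forest) := b << p.1 >> << p.2 >>.
rewrite /sweedler coshuffle_word -/(linext h _).
rewrite (is_linear_sum (linext_is_linear h)).
by apply: eq_bigr => p _; rewrite linext_basis.
Qed.

Lemma Bplus_is_linear : linear (@Bplus k).
Proof. exact: linext_is_linear. Qed.

Lemma Bplus_word f : Bplus (word f) = word [:: Node f].
Proof. exact: linext_basis. Qed.

Lemma BplusK : cancel (@Bplus k) (@Bminus k).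
Proof.
have BminusE A : Bminus A = linext (fun f : forest =>
    if fmonom_val f is [:: t] then word (branches t) else 0) A.
  by apply: eq_bigr => -[[|t []]] *; rewrite /= ?scaler0.
have Bminus_is_linear : linear (@Bminus k).
  by move=> a A B; rewrite !BminusE; exact: linext_is_linear.
apply: linear_eq_on_basis => [a A B | a A B | [f]] //.
  by rewrite Bplus_is_linear Bminus_is_linear.
by rewrite -/(word f) Bplus_word BminusE linext_basis.
Qed.

End FreeAlgebra.

Lemma tri_Bplus (k : fieldType) (tri : UgF k -> UgF k -> UgF k) :
  post_lie_grafting tri -> forall A B, tri A (Bplus B) = Bplus (star tri A B).
Proof.
move=> tri_grafting.
apply: (@tri_bplus k (UgF k : lalgType k) (@word k)).
- exact: word_nil.
- exact: word_cons.
- by move=> F G lF lG FG; apply: linear_eq_on_basis => // -[f]; exact: FG.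
- exact: malg_mul_is_linearr.
- by move=> B a A C; exact: tri_linearl.
- by move=> A a B C; exact: tri_linearr.
- exact: tri_1l.
- exact: tri_tree.
- by move=> f B C; rewrite (tri_mulr tri_grafting); exact: sweedler_word.
- move=> t f u; rewrite [in LHS]word_cons.
  by apply: tri_mull => //; exact: gF_tree.
- by move=> B; exact: sweedler_is_linear.
- by move=> f B; exact: sweedler_word.
- exact: Bplus_is_linear.
- exact: Bplus_word.
Qed.

Theorem proposition3p5 (k : fieldType) (k_char0 : [pchar k]%R =i pred0)
    (tri : UgF k -> UgF k -> UgF k) (tri_grafting : post_lie_grafting tri)
    (w1 w2 : UgF k) :
  star tri w1 w2 = grossman_larson tri w1 w2.
Proof. by rewrite /grossman_larson tri_Bplus // BplusK. Qed.
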